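(* Let $0<\alpha<1$. Then $\widetilde{W}^{\alpha,1}(\mathbb{R})\subseteq{}^{\pm}W^{\alpha,1}(\mathbb{R})$ for each choice of sign.
   Context: $\widetilde{W}^{\alpha,1}(\mathbb{R})=\Big\{u\in L^1(\mathbb{R}):\int_{\mathbb{R}}\int_{\mathbb{R}}\frac{|u(x)-u(y)|}{|x-y|^{1+\alpha}}\,dx\,dy<\infty\Big\}$ (Gagliardo type space). Fractional integrals on $\mathbb{R}$, for $\sigma>0$: ${}^{-}I^{\sigma}f(x)=\frac{1}{\Gamma(\sigma)}\int_{-\infty}^x\frac{f(y)}{(x-y)^{1-\sigma}}\,dy$ and ${}^{+}I^{\sigma}f(x)=\frac{1}{\Gamma(\sigma)}\int_x^\infty\frac{f(y)}{(y-x)^{1-\sigma}}\,dy$. For $0<\alpha<1$: ${}^{-}D^{\alpha}\varphi=\frac{d}{dx}\,{}^{-}I^{1-\alpha}\varphi$ and ${}^{+}D^{\alpha}\varphi=-\frac{d}{dx}\,{}^{+}I^{1-\alpha}\varphi$. Weak fractional derivatives ($0<\alpha<1$): for $u\in L^1(\mathbb{R})$, $v\in L^1_{loc}(\mathbb{R})$ is the left (resp. right) weak fractional derivative of $u$, written ${}^{-}\mathcal{D}^{\alpha}u=v$ (resp. ${}^{+}\mathcal{D}^{\alpha}u=v$), if $\int_{\mathbb{R}} v\varphi\,dx=\int_{\mathbb{R}} u\,{}^{+}D^{\alpha}\varphi\,dx$ (resp. with ${}^{-}D^{\alpha}\varphi$ on the right-hand side) for all $\varphi\in C_0^\infty(\mathbb{R})$.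 ${}^{\pm}W^{\alpha,1}(\mathbb{R})=\{u\in L^1(\mathbb{R}):{}^{\pm}\mathcal{D}^{\alpha}u\in L^1(\mathbb{R})\}$. *)

(* Defs.v *)
From HB Require Import structures.
From mathcomp Require Import all_boot all_order all_algebra.
From mathcomp Require Import all_classical all_reals all_analysis.
Set Implicit Arguments.
Unset Strict Implicit.
Unset Printing Implicit Defensive.
Import Order.TTheory GRing.Theory Num.Theory.
Import numFieldNormedType.Exports.
Local Open Scope classical_set_scope.
Local Open Scope ring_scope.

Section weak_fractional_derivatives.
Context {R : realType}.
Local Notation mu := (@lebesgue_measure R).
Implicit Types (alpha sigma : R) (u v f phi : R -> R).

Definition Gamma (s : R) : R :=
  \int[mu]_(t in `]0%R, +oo[) (t `^ (s - 1) * expR (- t)).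

Definition L1 : set (R -> R) := [set u | mu.-integrable setT (EFin \o u)].

(* On the diagonal x = y the integrand is 0 / 0 = 0; the diagonal is a null set. *)
Definition gagliardo_space alpha : set (R -> R) :=
  [set u | L1 u /\
    (\int[mu]_y \int[mu]_x (`|u x - u y| / `|x - y| `^ (1 + alpha))%:E
       < +oo)%E].

Definition left_frac_int sigma f (x : R) : R :=
  (Gamma sigma)^-1 *
  \int[mu]_(y in `]-oo, x[) (f y / (x - y) `^ (1 - sigma)).

Definition right_frac_int sigma f (x : R) : R :=
  (Gamma sigma)^-1 *
  \int[mu]_(y in `]x, +oo[) (f y / (y - x) `^ (1 - sigma)).

Definition left_frac_deriv alpha phi : R -> R :=
  derive1 (left_frac_int (1 - alpha) phi).

Definition right_frac_deriv alpha phi : R -> R :=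
  fun x => - derive1 (right_frac_int (1 - alpha) phi) x.

(* C_0^oo(R): smooth functions with compact support *)
Definition test_function phi : Prop :=
  (forall n x, derivable (derive1n n phi) x 1) /\
  compact (closure [set x | phi x != 0]).

(* The fractional derivative falling on the test function has the opposite
   direction. *)
Definition is_left_weak_frac_deriv alpha u v : Prop :=
  [/\ L1 u, locally_integrable setT v &
      forall phi, test_function phi ->
        \int[mu]_x (v x * phi x) =
        \int[mu]_x (u x * right_frac_deriv alpha phi x)].

Definition is_right_weak_frac_deriv alpha u v : Prop :=
  [/\ L1 u, locally_integrable setT v &
      forall phi, test_function phi ->
        \int[mu]_x (v x * phi x) =
        \int[mu]_x (u x * left_frac_deriv alpha phi x)].

Definition left_frac_sobolev alpha : set (R -> R) :=
  [set u | L1 u /\ exists2 v, is_left_weak_frac_deriv alpha u v & L1 v].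

Definition right_frac_sobolev alpha : set (R -> R) :=
  [set u | L1 u /\ exists2 v, is_right_weak_frac_deriv alpha u v & L1 v].

End weak_fractional_derivatives.

(* Main.v *)
(** The weak derivative is the Marchaud derivative
    [v(x) = alpha / Gamma(1 - alpha) * \int_0^oo (u(x) - u(x -+ s)) s^(-1 - alpha) ds],
    whose L^1 norm is dominated by the Gagliardo seminorm of [u].  For a test
    function, differentiating under the integral sign and writing
    [t^(-alpha) = alpha * \int_t^oo s^(-1 - alpha) ds], Fubini's theorem turns
    the fractional derivative into its Marchaud form
    [alpha / Gamma(1 - alpha) * \int_0^oo (phi(x) - phi(x +- s)) s^(-1 - alpha) ds].
    Integration by parts is then, for each fixed [s], translation invariance of
    Lebesgue measure, with Fubini's theorem exchanging the integrals in [x] and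
    [s].  Both signs are treated at once through a parameter [e = 1] or [e = -1]. *)

Require Import Defs.
From mathcomp Require Import all_boot all_order all_algebra.
From mathcomp Require Import all_classical all_reals all_analysis.
From mathcomp Require Import measurable_realfun lra.
Import Order.TTheory GRing.Theory Num.Theory.
Import numFieldNormedType.Exports.
Local Open Scope classical_set_scope.
Local Open Scope ring_scope.
Set Implicit Arguments.
Unset Strict Implicit.
Unset Printing Implicit Defensive.

(** * Invariance of Lebesgue measure and integral under translations and reflections *)

Section affine_invariance.
Context {R : realType}.
Local Notation mu := (@lebesgue_measure R).
Implicit Types (b e : R).
Lemma measurable_affine b e : measurable_fun [set: R] (fun x : R => b + e * x).
Proof.
apply: measurable_funD; first exact: measurable_cst.
exact: measurable_funM.
Qed.

(** Lebesgue measure is determined by its values on the intervals []p, q]], and the preimage of such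
    an interval is an interval of the same length. For [e = -1] the preimage is [[b - q, b - p[],
    with the open end switched, which leaves the length unchanged. *)
Lemma lebesgue_measure_affine b e (A : set R) : e = 1 \/ e = -1 ->
  measurable A -> pushforward mu ((fun x => b + e * x) : R -> measurableTypeR R) A = mu A.
Proof.
move=> he mA; apply/esym; have mf := measurable_affine b e.
unshelve eapply lebesgue_measure_unique; [exact: mf | | exact: mA].
move=> X [[p q] _ <-] /=.
rewrite /pushforward /=.
case: he mf => -> mf.
  have -> : (fun x => b + 1 * x) @^-1` `]p, q]%classic = `]p - b, q - b]%classic.
    by apply/seteqP; split => x /=; rewrite !in_itv/= => /andP[? ?]; apply/andP; split; lra.
  rewrite !lebesgue_measure_itv /= !lte_fin -!EFinB.
  by rewrite ltrD2r; case: ifP => // _; congr EFin; lra.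
have -> : (fun x => b + -1 * x) @^-1` `]p, q]%classic = `[b - q, b - p[%classic.
  by apply/seteqP; split => x /=; rewrite !in_itv/= => /andP[? ?]; apply/andP; split; lra.
rewrite !lebesgue_measure_itv /= !lte_fin -!EFinB.
by rewrite ltrD2l ltrN2; case: ifP => // _; congr EFin; lra.
Qed.

Lemma ge0_integral_affine b e (f : R -> \bar R) : e = 1 \/ e = -1 ->
  measurable_fun [set: R] f -> (forall x, 0%E <= f x)%E ->
  (\int[mu]_x f (b + e * x)%R = \int[mu]_x f x)%E.
Proof.
move=> he mf f0; have ma := measurable_affine b e.
have := @ge0_integral_pushforward _ _ (measurableTypeR R) (measurableTypeR R) R
  ((fun x => b + e * x) : R -> measurableTypeR R) ma mu setT f measurableT mf (fun y _ => f0 y).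
rewrite preimage_setT => <-.
by apply: eq_measure_integral => A mA _; exact: lebesgue_measure_affine.
Qed.

Lemma integral_affine b e (f : R -> \bar R) : e = 1 \/ e = -1 ->
  measurable_fun [set: R] f ->
  (\int[mu]_x f (b + e * x)%R = \int[mu]_x f x)%E.
Proof.
move=> he mf; rewrite integralE [RHS]integralE.
rewrite -(ge0_integral_affine b he (measurable_funepos mf))//.
rewrite -(ge0_integral_affine b he (measurable_funeneg mf))//.
by congr (_ - _)%E; apply: eq_integral => x _; rewrite ?funeposE ?funenegE.
Qed.

Lemma Rintegral_affine b e (f : R -> R) : e = 1 \/ e = -1 ->
  measurable_fun [set: R] f ->
  \int[mu]_x f (b + e * x) = \int[mu]_x f x.
Proof.
move=> he mf; rewrite /Rintegral.
by rewrite (@integral_affine b e (EFin \o f))//; exact/measurable_EFinP.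
Qed.

Lemma integrable_affine b e (f : R -> R) : e = 1 \/ e = -1 ->
  mu.-integrable setT (EFin \o f) ->
  mu.-integrable setT (EFin \o (fun x => f (b + e * x))).
Proof.
move=> he /integrableP[mf foo]; apply/integrableP; split.
  apply: (measurableT_comp mf); exact: measurable_affine.
rewrite (@ge0_integral_affine b e (fun x => `|(f x)%:E|)%E)//.
exact: measurableT_comp.
Qed.

End affine_invariance.

(** * Fubini's theorem for real-valued integrals *)

Lemma abse_fine_le (R : realType) (y : \bar R) : (`|(fine y)%:E| <= `|y|)%E.
Proof. by case: y => [r||] //=; rewrite leey. Qed.

Section Rfubini.
Context {R : realType}.
Local Notation mu := (@lebesgue_measure R).
Variable g : R -> R -> R.
Hypothesis ig : (mu \x mu)%E.-integrable setT (fun z => (g z.1 z.2)%:E).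

(** The inner integral is known to be finite only for almost every [x]. The real integral replaces
    an infinite value by 0, which can only lower the absolute value, so integrability carries over
    from the extended inner integral. *)
Lemma integrable_Rintegral :
  mu.-integrable setT (EFin \o (fun x => \int[mu]_y g x y)).
Proof.
have iF := integrable_fubini_F ig.
change (mu.-integrable setT
  (fun x => (fine (fubini_F mu (fun z => (g z.1 z.2)%:E) x))%:E)).
apply/integrableP; split.
  apply/measurable_EFinP; apply: measurableT_comp => //.
  exact: measurable_int iF.
move/integrableP : iF => [mF]; apply: le_lt_trans.
apply: ge0_le_integral => //.
- do 2 apply: measurableT_comp => //.
  exact: measurableT_comp.
- exact: measurableT_comp.
- by move=> x _; exact: abse_fine_le.
Qed.

(** The real and the extended inner integrals agree wherever the latter are finite, hence almost
    everywhere, so the extended Fubini theorem transfers. *)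
Lemma Rfubini :
  \int[mu]_x \int[mu]_y g x y = \int[mu]_y \int[mu]_x g x y.
Proof.
rewrite /Rintegral; congr fine.
have iF := integrable_fubini_F ig.
transitivity (\int[mu]_x \int[mu]_y (g x y)%:E)%E.
  apply: ae_eq_integral => //.
  - exact: measurable_int integrable_Rintegral.
  - exact: measurable_int iF.
  - have := integrable_ae measurableT iF; apply: filterS => x /= /(_ I) h _.
    by rewrite fineK.
rewrite (Fubini ig).
apply: ae_eq_integral => //.
- exact: (measurable_fubini_G ig).
- apply/measurable_EFinP; apply: measurableT_comp => //.
  exact: (measurable_fubini_G ig).
- have := ae_integrable2 ig; apply: filterS => y iy _.
  by rewrite /fubini_G /= fineK//; exact: integrable_fin_num.
Qed.

End Rfubini.

(** * Powers truncated to the positive half-line, and their integrals *)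

Section truncated_power.
Context {R : realType}.
Local Notation mu := (@lebesgue_measure R).
Implicit Types (a p s t : R).

(* [tpow 0] is the Heaviside function: it encodes the domains of integration, so
   that every integral below is over the whole line. *)
Definition tpow p s : R := if 0 < s then s `^ p else 0.

Lemma tpow_ge0 p s : 0 <= tpow p s.
Proof. by rewrite /tpow; case: ifP => // _; exact: powR_ge0. Qed.

Lemma measurable_tpow p : measurable_fun [set: R] (tpow p).
Proof.
apply: measurable_fun_if => //.
- exact: measurable_fun_ltr.
- apply: measurable_funTS; exact: (measurable_powR p).
Qed.

Lemma derivable_powRc p (t : R) : 0 < t -> derivable (fun x => x `^ p) t 1.
Proof. by move=> t0; apply: derivable_powR; rewrite in_itv/= t0. Qed.

Lemma derive1_powR_primitive p (t : R) : p + 1 != 0 -> 0 < t ->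
  derivable (fun x => (p + 1)^-1 * x `^ (p + 1)) t 1 /\
  derive1 (fun x => (p + 1)^-1 * x `^ (p + 1)) t = t `^ p.
Proof.
move=> p0 t0; have d := @derivable_powRc (p + 1) t t0.
split; first by apply: derivableM; [exact: derivable_cst|exact: d].
rewrite derive1E deriveMl// -derive1E powR_derive1 ?in_itv/= ?t0//.
by rewrite addrK mulrA mulVf ?mul1r.
Qed.

Lemma powRN_cvg0 a : 0 < a -> x `^ (- a) @[x --> +oo] --> 0.
Proof.
move=> a0; apply/cvgrPdist_le => e e0; near=> x.
(* This threshold solves [x^(-a) = e]. *)
have ex : e^-1 `^ a^-1 <= x by near: x; exact: nbhs_pinfty_ge.
rewrite sub0r normrN ger0_norm ?powR_ge0// powRN.
have x0 : 0 < x by apply: lt_le_trans ex; rewrite powR_gt0// invr_gt0.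
rewrite invf_ple ?posrE ?powR_gt0//.
have -> : e^-1 = (e^-1 `^ a^-1) `^ a.
  by rewrite -powRrM mulVf ?gt_eqF// powRr1// invr_ge0 ltW.
by apply: ge0_ler_powR; rewrite ?nnegrE ?powR_ge0//; exact: ltW.
Unshelve. all: by end_near. Qed.

(** The primitive [- s^(-a) / a] vanishes at infinity. This identity represents the kernel [t^(-a)]
    as a superposition of the indicators of [t < s]. *)
Lemma integral_tpow_tail a t : 0 < a -> 0 < t ->
  (\int[mu]_s (tpow 0 (s - t) * tpow (- 1 - a) s)%:E = (a^-1 * t `^ (- a))%:E)%E.
Proof.
move=> a0 t0.
have mf : measurable_fun [set: R] (fun x : R => x `^ (- 1 - a)) by exact: measurable_powR.
transitivity (\int[mu]_(s in `]t, +oo[) (s `^ (- 1 - a))%:E)%E.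
  rewrite [RHS]integral_mkcond; apply: eq_integral => s _.
  rewrite patchE /tpow subr_gt0 mem_setE in_itv/= andbT; case: ifP => ts; rewrite ?mul0r//.
  by rewrite powRr0 mul1r (lt_trans t0 ts).
rewrite integral_itv_obnd_cbnd; last exact/measurable_EFinP/measurable_funTS.
have pN : - 1 - a + 1 = - a by lra.
have p0 : - 1 - a + 1 != 0 by rewrite pN oppr_eq0 gt_eqF.
have dF x : t <= x -> derivable (fun x => (- 1 - a + 1)^-1 * x `^ (- 1 - a + 1)) x 1.
  by move=> tx; have [] := derive1_powR_primitive p0 (lt_le_trans t0 tx).
rewrite (@ge0_continuous_FTC2y _ _ (fun x => (- 1 - a + 1)^-1 * x `^ (- 1 - a + 1)) _ 0).
- by rewrite -EFinB pN sub0r invrN mulNr opprK.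
- by move=> x _; exact: powR_ge0.
- apply: derivable_within_continuous => x; rewrite in_itv/= andbT => tx.
  exact: (derivable_powRc (lt_le_trans t0 tx)).
- rewrite pN -[X in _ --> X](mulr0 (- a)^-1).
  by apply: cvgMr; exact: powRN_cvg0.
- by move=> x tx; apply: dF; exact: ltW.
- apply: cvg_at_right_filter.
  have /derivable1_diffP := dF t (lexx t).
  by move=> /differentiable_continuous.
- move=> x; rewrite in_itv/= andbT => tx.
  by have [] := derive1_powR_primitive p0 (lt_trans t0 tx).
Qed.

(** The integrand is unbounded at 0, so the fundamental theorem of calculus is applied on
    [[T / (n + 2), T]] and monotone convergence bounds the integral by [T^(1 - a) / (1 - a)]. *)
Lemma integrable_tpow_head a T : 0 < a < 1 -> 0 < T ->
  mu.-integrable setT (EFin \o (fun t => tpow 0 (T - t) * tpow (- a) t)).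
Proof.
move=> /andP[a0 a1] T0.
have mf : measurable_fun [set: R] (fun x : R => x `^ (- a)) by exact: measurable_powR.
apply/integrableP; split.
  apply/measurable_EFinP; apply: measurable_funM; last exact: measurable_tpow.
  apply: measurableT_comp; first exact: measurable_tpow.
  exact: measurable_funB.
set C := (- a + 1)^-1 * T `^ (- a + 1).
apply: (@le_lt_trans _ _ C%:E); last exact: ltry.
(* The denominator starts at 2 so that the interval is nondegenerate already for [n = 0]. *)
pose F (n : nat) : set R := `[T / n.+2%:R, T]%classic.
have p0 : - a + 1 != 0 by rewrite gt_eqF//; lra.
have Tn n : 0 < T / n.+2%:R by rewrite divr_gt0.
have FE : \bigcup_n F n = `]0, T]%classic.
  apply/seteqP; split => [x [n _]|x]; rewrite ?/F/= ?in_itv/= => /andP[x0 xT].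
    by rewrite (lt_le_trans (Tn n) x0).
  (* With this index [T / x < n + 1 <= n + 2], hence [T / (n + 2) <= x]. *)
  exists (Num.truncn (T / x)) => //=; rewrite /F/= in_itv/= xT andbT.
  rewrite ler_pdivrMr// mulrC -ler_pdivrMr//.
  apply: le_trans (ltW (truncnS_gt _)) _.
  by rewrite ler_nat.
have -> : (\int[mu]_t `|(EFin \o (fun t => tpow 0 (T - t) * tpow (- a) t)%R) t| =
    \int[mu]_(t in \bigcup_n F n) (t `^ (- a))%:E)%E.
  rewrite FE -integral_itv_bndo_bndc; last exact/measurable_EFinP/measurable_funTS.
  rewrite [RHS]integral_mkcond; apply: eq_integral => s _ /=.
  rewrite ger0_norm ?mulr_ge0 ?tpow_ge0// patchE /tpow subr_gt0 mem_setE in_itv/=.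
  by case: (ltP 0 s) => _; case: (ltP s T) => _; rewrite ?mul0r ?mulr0// powRr0 mul1r.
have FF : {homo F : n m / (n <= m)%N >-> (n <= m)%O}.
  move=> n m nm; rewrite /F; apply/subsetPset/subset_itvr; rewrite bnd_simp.
  by rewrite ler_pM2l// lef_pV2 ?posrE// ler_nat !ltnS.
have mFf i : measurable_fun (F i) (fun t : R => (t `^ (- a))%:E).
  exact/measurable_EFinP/measurable_funTS.
have Ff0 i (x : R) : F i x -> (0 <= (x `^ (- a))%:E)%E by rewrite lee_fin powR_ge0.
have mF i : measurable (F i) by exact: measurable_itv.
have Fcvg := @ge0_nondecreasing_set_cvg_integral _ (measurableTypeR R) R F _ mu FF mF mFf Ff0.
rewrite -(cvg_lim _ Fcvg)//.
apply: lime_le.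
  by apply/cvg_ex; eexists; exact: Fcvg.
apply: nearW => n.
rewrite (@continuous_FTC2 _ _ (fun x => (- a + 1)^-1 * x `^ (- a + 1))) //.
- rewrite -EFinB lee_fin lerBlDr lerDl mulr_ge0 ?powR_ge0// invr_ge0; lra.
- by rewrite ltr_pdivrMr// ltr_pMr// ltr1n.
- apply: derivable_within_continuous => x; rewrite in_itv/= => /andP[tx _].
  exact: (derivable_powRc (lt_le_trans (Tn n) tx)).
- have dF (x : R) : 0 < x -> derivable (fun x => (- a + 1)^-1 * x `^ (- a + 1)) x 1.
    by move=> x0; have [] := derive1_powR_primitive p0 x0.
  split.
  + by move=> x; rewrite in_itv/= => /andP[tx _]; apply: dF; exact: lt_trans tx.
  + apply: cvg_at_right_filter.
    by have /derivable1_diffP/differentiable_continuous := dF _ (Tn n).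
  + apply: cvg_at_left_filter.
    by have /derivable1_diffP/differentiable_continuous := dF _ T0.
- move=> x; rewrite in_itv/= => /andP[tx _].
  by have [] := derive1_powR_primitive p0 (lt_trans (Tn n) tx).
Qed.

End truncated_power.

(** * Boundedness, support and integrability of test functions *)

Section test_functions.
Context {R : realType}.
Local Notation mu := (@lebesgue_measure R).
Implicit Types (f phi : R -> R).

Lemma bounded_of_support f A : continuous f ->
  (forall x, A < `|x| -> f x = 0) -> exists M, 0 < M /\ forall x, `|f x| <= M.
Proof.
move=> cf f0.
(* Passing to [|A|] keeps the interval nonempty whatever the sign of [A]. *)
have A0 : - `|A| <= `|A| by rewrite ge0_cp.
have cnf : {within `[- `|A|, `|A|], continuous (fun x => `|f x|)}.
  apply: continuous_subspaceT => x; apply: continuous_comp; first exact: cf.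
  exact: norm_continuous.
have [c _ fc] := EVT_max A0 cnf.
exists (`|f c| + 1); split; first by rewrite ltr_wpDl.
move=> x; have [xA|xA] := leP `|x| `|A|.
  by rewrite (le_trans (fc x _)) ?lerDl// in_itv/= -ler_norml.
rewrite f0 ?normr0 ?addr_ge0//.
by rewrite (le_lt_trans _ xA)// ler_norm.
Qed.

(** The arguments below use a test function through these three facts. The derivative vanishes
    beyond [A] because [A < |x|] is an open condition, so [phi] is zero near each such point. *)
Lemma test_functionP phi : test_function phi ->
  [/\ forall x, derivable phi x 1,
      continuous (derive1 phi) &
      exists A, 0 < A /\ forall x, A < `|x| -> phi x = 0 /\ derive1 phi x = 0].
Proof.
move=> [dphi cphi]; split.
- exact: (dphi 0%N).
- by move=> x; apply/differentiable_continuous/derivable1_diffP; exact: (dphi 1%N).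
have [A0 [_ /(_ _ _) hA]] := compact_bounded cphi.
have hB x : phi x != 0 -> `|x| <= `|A0| + 1.
  move=> px; apply: (hA (`|A0| + 1)).
    by rewrite (le_lt_trans (ler_norm _))// ltrDl.
  exact: subset_closure.
have h0 x : `|A0| + 1 < `|x| -> phi x = 0.
  by move=> Ax; apply: contraTeq Ax => /hB; rewrite -leNgt.
exists (`|A0| + 1); split; first by rewrite ltr_wpDl.
move=> x Ax; split; first exact: h0.
rewrite derive1E (@near_eq_derive _ _ _ _ (cst 0)) ?derive_cst//.
near=> y; apply: h0; near: y.
have : `|y| @[y --> x] --> `|x| by exact: norm_continuous.
by move/cvgr_gt; apply.
Unshelve. all: by end_near. Qed.

Lemma integrable_of_support f A : continuous f ->
  (forall x, A < `|x| -> f x = 0) -> mu.-integrable setT (EFin \o f).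
Proof.
move=> cf f0; have [M [M0 fM]] := bounded_of_support cf f0.
have mf : measurable_fun [set: R] f by exact: continuous_measurable_fun.
have := integrableZl measurableT M (integrable_indic_itv (- A) A true false).
apply: le_integrable => //; first exact/measurable_EFinP.
move=> x _ /=; rewrite lee_fin indicE mem_setE in_itv/= -ler_norml.
have [_|Ax] := leP `|x| A; first by rewrite mulr1 (gtr0_norm M0).
by rewrite f0// normr0 normr_ge0.
Qed.

End test_functions.

(** * Differentiating the fractional integral of a test function *)

Section fractional_derivative_of_test_functions.
Context {R : realType}.
Local Notation mu := (@lebesgue_measure R).
Implicit Types (a e x : R) (f phi : R -> R).

Lemma is_derive_affine (x e t : R) : is_derive t (1:R) (fun t : R => x + e * t) e.
Proof.
have h := is_deriveD (is_derive_cst x t (1:R)) (is_deriveZ e (is_derive_id t (1:R))).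
rewrite (_ : (fun _ => _) = cst x + e *: id)%R; last first.
  by apply/funext => y.
apply: is_derive_eq.
by rewrite add0r; exact: mulr1.
Qed.

Lemma derive1_comp_affine (f : R -> R) x e t : derivable f (x + e * t) 1 ->
  derivable (fun t => f (x + e * t)) t 1 /\
  derive1 (fun t => f (x + e * t)) t = derive1 f (x + e * t) * e.
Proof.
move=> df.
have h1 := is_derive_affine x e t.
have h2 : is_derive (x + e * t) 1 f (derive1 f (x + e * t)).
  by rewrite derive1E; exact: DeriveDef.
have h := @is_derive1_comp R f (fun t => x + e * t) t _ e h2 h1.
split; first exact: ex_derive.
by rewrite derive1E; exact: derive_val.
Qed.
Lemma measurable_comp_affine f b e : measurable_fun [set: R] f ->
  measurable_fun [set: R] (fun x => f (b + e * x)).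
Proof. by move=> mf; apply: measurableT_comp => //; exact: measurable_affine. Qed.

(** For [t >= |x| + |A| + 1] the point [x + e * t] has absolute value at least [t - |x| > A], so [f]
    vanishes there; below this threshold the integrand is at most [M * t^(-a)]. *)
Lemma integrable_support_tpow f A x a e : continuous f -> e = 1 \/ e = -1 ->
  0 < a < 1 ->
  (forall x, A < `|x| -> f x = 0) ->
  mu.-integrable setT (EFin \o (fun t => f (x + e * t) * tpow (- a) t)).
Proof.
move=> cf he a01 f0; have [M [M0 fM]] := bounded_of_support cf f0.
have T0 : 0 < `|x| + `|A| + 1 by rewrite ltr_wpDl// addr_ge0.
have := integrableZl measurableT M (integrable_tpow_head a01 T0).
apply: le_integrable => //.
  apply/measurable_EFinP; apply: measurable_funM; last exact: measurable_tpow.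
  by apply: measurable_comp_affine; exact: continuous_measurable_fun.
move=> t _ /=; rewrite lee_fin !normrM (gtr0_norm M0) !(ger0_norm (tpow_ge0 _ _)).
have e1 : `|e| = 1 by case: he => ->; rewrite ?normrN normr1.
rewrite {2}/tpow subr_gt0; case: ifPn => [_|].
  by rewrite powRr0 mul1r ler_wpM2r// tpow_ge0.
rewrite -leNgt => tx; rewrite f0 ?normr0 ?mul0r ?mulr0//.
have := lerB_normD (e * t) x; rewrite normrM e1 mul1r (addrC _ x).
have := ler_norm t; have := ler_norm A; lra.
Qed.

(** In this form [x] enters only through [phi] and the singular kernel stays fixed, so the
    derivative can pass under the integral by dominated convergence. *)
Lemma derive1_frac_int phi x a e : test_function phi -> e = 1 \/ e = -1 ->
  0 < a < 1 ->
  derivable (fun x => \int[mu]_t (phi (x + e * t) * tpow (- a) t)) x 1 /\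
  derive1 (fun x => \int[mu]_t (phi (x + e * t) * tpow (- a) t)) x =
  \int[mu]_t (derive1 phi (x + e * t) * tpow (- a) t).
Proof.
move=> /test_functionP[dphi cdphi [A [A0 phi0]]] he a01.
have cphi : continuous phi.
  by move=> y; apply/differentiable_continuous/derivable1_diffP.
have supp y : A < `|y| -> phi y = 0 by move=> /phi0[].
have supp' y : A < `|y| -> derive1 phi y = 0 by move=> /phi0[].
have [M [M0 dM]] := bounded_of_support cdphi supp'.
have T0 : 0 < `|x| + 1 + A + 1 by rewrite ltr_wpDl// ltW// addr_gt0// ltr_wpDl.
have e1 : `|e| = 1 by case: he => ->; rewrite ?normrN normr1.
pose f (x t : R) := phi (x + e * t) * tpow (- a) t.
have df y t : derivable (f ^~ t) y 1 /\
    partial1of2 f y t = derive1 phi (y + e * t) * tpow (- a) t.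
  (* The derivative is taken in [y], so [e * t] is now the base point and the slope is 1. *)
  have [] := @derive1_comp_affine phi (e * t) 1 y; first exact: dphi.
  rewrite mulr1 mul1r addrC => d1 d2.
  have fE : (fun z => phi (e * t + 1 * z)) = (fun z => phi (z + e * t)).
    by apply/funext => z; rewrite mul1r addrC.
  rewrite fE in d1 d2.
  split; first (rewrite /f; apply: derivableM; [exact: d1|]; exact: derivable_cst).
  rewrite /partial1of2 derive1E deriveMr// -derive1E d2 mulrC//.
have xI : x \in `]x - 1, x + 1[%classic by rewrite mem_setE in_itv/=; apply/andP; split; lra.
(* One majorant for all [y] within distance 1 of [x]: there [|y| <= |x| + 1], so beyond the cutoff
   [|y + e * t| >= t - |y| > A]. *)
pose G t := M * (tpow 0 (`|x| + 1 + A + 1 - t) * tpow (- a) t).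
have fint y : `]x - 1, x + 1[%classic y -> mu.-integrable setT (EFin \o f y).
  by move=> _; exact: (integrable_support_tpow y cphi he a01 supp).
have fder y t : `]x - 1, x + 1[%classic y -> setT t -> derivable (f ^~ t) y 1.
  by move=> _ _; have [] := df y t.
have G0 t : 0 <= G t by rewrite /G !mulr_ge0 ?tpow_ge0// ltW.
have iG : mu.-integrable setT (EFin \o G).
  exact: (integrableZl measurableT M (integrable_tpow_head a01 T0)).
have fG y t : `]x - 1, x + 1[%classic y -> setT t -> `|partial1of2 f y t| <= G t.
  rewrite /= in_itv/= => /andP[xy yx] _.
  rewrite (df _ _).2 /G normrM (ger0_norm (tpow_ge0 _ _)).
  rewrite {2}/tpow subr_gt0; case: ifPn => [_|].
    by rewrite powRr0 mul1r ler_wpM2r// tpow_ge0.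
  rewrite -leNgt => tx; rewrite supp' ?normr0 ?mul0r ?mulr0//.
  have := lerB_normD (e * t) y; rewrite normrM e1 mul1r (addrC _ y).
  have := ler_norm t.
  have : `|y| <= `|x| + 1.
    have := ler_normD (y - x) x; rewrite subrK.
    have : `|y - x| <= 1 by rewrite ler_norml; apply/andP; split; lra.
    lra.
  lra.
split.
  exact: (@derivable_under_integral R _ (measurableTypeR R) mu f setT measurableT
    x _ _ (set_mem xI) fint fder G G0 iG fG).
rewrite (@differentiation_under_integral R _ (measurableTypeR R) mu f setT measurableT
    x _ _ (set_mem xI) fint fder G G0 iG fG).
by apply: eq_Rintegral => t _; rewrite /= (df _ _).2.
Qed.

End fractional_derivative_of_test_functions.

(** * The Marchaud form of the fractional derivative of a test function *)

Section marchaud.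
Context {R : realType}.
Local Notation mu := (@lebesgue_measure R).
Implicit Types (a e x : R) (f phi : R -> R).

(** The integral is split at [t = 1]. Below 1, [|f| <= M] and [t^(-a)] is integrable; above 1,
    [t^(-a) <= 1] and what remains is at most the [L^1] norm of [f], which is independent of [x] by
    affine invariance. *)
Lemma integral_tpow_uniform_bound f A a e : continuous f -> e = 1 \/ e = -1 ->
  0 < a < 1 -> (forall x, A < `|x| -> f x = 0) ->
  exists C, forall x,
    (\int[mu]_t (`|f (x + e * t)| * tpow (- a) t)%:E <= C%:E)%E.
Proof.
move=> cf he a01 f0; have [M [M0 fM]] := bounded_of_support cf f0.
have mf := continuous_measurable_fun cf.
have i1 := integrableZl measurableT M (integrable_tpow_head a01 (@ltr01 R)).
have i2 := integrable_abse (integrable_of_support cf f0).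
set I1 := (\int[mu]_t (M%:E * (EFin \o (fun t => tpow 0 (1 - t) * tpow (- a) t)%R) t))%E.
set I2 := (\int[mu]_t `|(EFin \o f) t|)%E.
have f1 : I1 \is a fin_num by exact: integrable_fin_num i1.
have f2 : I2 \is a fin_num by exact: integrable_fin_num i2.
exists (fine I1 + fine I2) => x.
rewrite EFinD !fineK//.
rewrite /I2 -(@ge0_integral_affine R x e (fun t => `|(EFin \o f) t|)%E)//; last first.
  by apply: measurableT_comp => //; exact/measurable_EFinP.
have mfx : measurable_fun [set: R] (fun t => f (x + e * t)) by exact: measurable_comp_affine.
have mt1 : measurable_fun [set: R] (fun t : R => tpow 0 (1 - t)).
  apply: measurableT_comp; first exact: measurable_tpow.
  exact: measurable_funB.
have mt := @measurable_tpow R (- a).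
rewrite -ge0_integralD//; last 3 first.
- by move=> t _; rewrite lee_fin !mulr_ge0 ?tpow_ge0// ltW.
- by apply/measurable_EFinP; do 2 apply: measurable_funM => //.
- by apply/measurable_EFinP; apply: measurableT_comp.
apply: ge0_le_integral => //.
- by move=> t _; rewrite lee_fin mulr_ge0 ?tpow_ge0.
- by apply/measurable_EFinP; apply: measurable_funM => //; apply: measurableT_comp.
- apply: emeasurable_funD.
    by apply/measurable_EFinP; do 2 apply: measurable_funM => //.
  by apply/measurable_EFinP; apply: measurableT_comp.
move=> t _ /=; rewrite -EFinM -EFinD lee_fin.
rewrite {2}/tpow subr_gt0; case: ifPn => [_|].
  by rewrite powRr0 mul1r ler_wpDr// ler_wpM2r// tpow_ge0.
rewrite -leNgt => t1; rewrite mul0r mulr0 add0r ler_piMr//.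
rewrite /tpow (lt_le_trans _ t1)// powRN invf_le1 ?powR_gt0 ?(lt_le_trans _ t1)//.
apply: (@le_trans _ _ (1 `^ a)); first by rewrite powR1.
apply: ge0_ler_powR; rewrite ?nnegrE//; lra.
Qed.

(** Since [e^2 = 1], [t |-> e * phi (x + e * t)] is a primitive of [phi'(x + e * t)], and the two
    Heaviside factors cut the line down to []0, s[]. *)
Lemma integral_derive1_tpow phi x e s : (forall x, derivable phi x 1) ->
  continuous (derive1 phi) -> e = 1 \/ e = -1 -> 0 < s ->
  \int[mu]_t (derive1 phi (x + e * t) * (tpow 0 t * tpow 0 (s - t))) =
  e * (phi (x + e * s) - phi x).
Proof.
move=> dphi cphi he s0.
have ee : e * e = 1 by case: he => ->; rewrite ?mulrNN mulr1.
have mf := continuous_measurable_fun cphi.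
have mfx : measurable_fun [set: R] (fun t => derive1 phi (x + e * t)).
  exact: measurable_comp_affine.
(* The value at the lower end is written as [x + e * 0] to match the primitive at 0. *)
rewrite (_ : e * (_ - _) = fine ((e * phi (x + e * s))%:E - (e * phi (x + e * 0))%:E)); last first.
  by rewrite mulr0 addr0 -EFinB/= mulrBr.
congr fine.
pose F := fun t : R => e * phi (x + e * t).
have dF t : derivable F t 1 /\ derive1 F t = derive1 phi (x + e * t).
  have [d1 d2] := derive1_comp_affine (dphi (x + e * t)).
  split; first by apply: derivableM; [exact: derivable_cst|].
  by rewrite /F derive1E deriveMl// -derive1E d2 mulrCA ee mulr1.
have cF t : F y @[y --> t] --> F t.
  by have /derivable1_diffP/differentiable_continuous := (dF t).1.
rewrite -(@continuous_FTC2 _ (fun t => derive1 phi (x + e * t)) F)//.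
- rewrite -(@integral_itv_obnd_cbnd _ 0 (BRight s)); last first.
    exact/measurable_EFinP/measurable_funTS.
  rewrite -integral_itv_bndo_bndc; last exact/measurable_EFinP/measurable_funTS.
  rewrite [RHS]integral_mkcond; apply: eq_integral => t _ /=.
  rewrite patchE /tpow subr_gt0 mem_setE in_itv/=.
  by case: (ltP 0 t) => _; case: (ltP t s) => _; rewrite ?mul0r ?mulr0// !powRr0 !mulr1.
- apply: continuous_subspaceT => t.
  apply: (@continuous_comp _ _ _ (fun y : R => x + e * y)); last exact: cphi.
  by apply: continuousD; [exact: cst_continuous|apply: continuousM; [exact: cst_continuous|]].
- split.
  + by move=> t _; exact: (dF t).1.
  + exact: cvg_at_right_filter.
  + exact: cvg_at_left_filter.
- by move=> t _; exact: (dF t).2.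
Qed.

(** Fubini for [phi'(x + e * t) * s^(-1 - a)] on [0 < t < s]. The constant [C] serves all [x] at
    once; this uniformity later makes the product with an integrable [u] integrable in both
    variables. *)
Lemma marchaud phi a e : test_function phi -> e = 1 \/ e = -1 -> 0 < a < 1 ->
  exists C, forall x,
  [/\ mu.-integrable setT
        (EFin \o (fun s => (phi (x + e * s) - phi x) * tpow (- 1 - a) s)),
      (\int[mu]_s `|(phi (x + e * s) - phi x) * tpow (- 1 - a) s|%:E <= C%:E)%E &
      e * \int[mu]_t (derive1 phi (x + e * t) * tpow (- a) t) =
      a * \int[mu]_s ((phi (x + e * s) - phi x) * tpow (- 1 - a) s)].
Proof.
move=> /test_functionP[dphi cdphi [A [A0 phi0]]] he a01.
have a0 : 0 < a by case/andP: a01.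
have cphi : continuous phi.
  by move=> y; apply/differentiable_continuous/derivable1_diffP.
have supp' y : A < `|y| -> derive1 phi y = 0 by move=> /phi0[].
have [C hC] := integral_tpow_uniform_bound cdphi he a01 supp'.
have ee : e * e = 1 by case: he => ->; rewrite ?mulrNN mulr1.
have e1 : `|e| = 1 by case: he => ->; rewrite ?normrN normr1.
have eK y : e * (e * y) = y by rewrite mulrA ee mul1r.
exists (a^-1 * C) => x.
(* Integrating in [s] first gives [t^(-a) / a]; integrating in [t] first gives
   an increment of [phi]. *)
pose g (s t : R) := derive1 phi (x + e * t) * (tpow 0 t * tpow 0 (s - t)) * tpow (- 1 - a) s.
have mg : measurable_fun [set: R * R] (fun z : R * R => g z.1 z.2).
  apply: measurable_funM; last first.
    by apply: measurableT_comp; [exact: measurable_tpow|exact: measurable_fst].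
  apply: measurable_funM.
    apply: (measurableT_comp (f := fun t : R => derive1 phi (x + e * t))).
      by apply: measurable_comp_affine; exact: continuous_measurable_fun.
    exact: measurable_snd.
  apply: measurable_funM.
    by apply: measurableT_comp; [exact: measurable_tpow|exact: measurable_snd].
  apply: measurableT_comp; first exact: measurable_tpow.
  by apply: measurable_funB; [exact: measurable_fst|exact: measurable_snd].
have mgT t : measurable_fun [set: R] (fun s => g s t).
  exact: (measurableT_comp (f := fun z : R * R => g z.1 z.2) mg (measurable_pair2 t)).
have mgS s : measurable_fun [set: R] (g s).
  exact: (measurableT_comp (f := fun z : R * R => g z.1 z.2) mg (measurable_pair1 s)).
have mtail t : measurable_fun [set: R] (fun s : R => tpow 0 (s - t) * tpow (- 1 - a) s).
  apply: measurable_funM; last exact: measurable_tpow.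
  by apply: measurableT_comp; [exact: measurable_tpow|exact: measurable_funB].
have itail t : 0 < t -> mu.-integrable setT
    (EFin \o (fun s => tpow 0 (s - t) * tpow (- 1 - a) s)).
  move=> t0; apply/integrableP; split.
    apply/measurable_EFinP. exact: mtail.
  under eq_integral do rewrite /= ger0_norm ?mulr_ge0 ?tpow_ge0//.
  by rewrite integral_tpow_tail// ltry.
have mabs : measurable_fun [set: R] (fun t => `|derive1 phi (x + e * t)| * tpow (- a) t).
  apply: measurable_funM; last exact: measurable_tpow.
  apply: measurableT_comp => //; apply: measurable_comp_affine.
  exact: continuous_measurable_fun.
(* Integrating in [s] first turns the tail into [t^(-a) / a], and the uniform bound [C] on the
   remaining integral gives [C / a]. *)
have gabs : (\int[mu]_t \int[mu]_s `|g s t|%:E <= (a^-1 * C)%:E)%E.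
  rewrite (_ : (\int[mu]_t \int[mu]_s `|g s t|%:E) =
      \int[mu]_t (a^-1%:E * (`|derive1 phi (x + e * t)| * tpow (- a) t)%:E))%E; last first.
    apply: eq_integral => t _.
    transitivity (\int[mu]_s ((`|derive1 phi (x + e * t)| * tpow 0 t)%:E *
        (tpow 0 (s - t) * tpow (- 1 - a) s)%:E))%E.
      apply: eq_integral => s _; rewrite -EFinM; congr EFin.
      by rewrite /g !normrM !(ger0_norm (tpow_ge0 _ _)) !mulrA.
    rewrite ge0_integralZl_EFin//; last 3 first.
    - by move=> s _; rewrite lee_fin mulr_ge0 ?tpow_ge0.
    - by apply/measurable_EFinP; exact: mtail.
    - by rewrite mulr_ge0 ?tpow_ge0.
    have [t0|t0] := ltP 0 t.
      rewrite integral_tpow_tail// -!EFinM /tpow t0 powRr0 mulr1; congr EFin.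
      by rewrite mulrCA.
    by rewrite /tpow ltNge t0 /= !mulr0 mul0e mule0.
  rewrite ge0_integralZl_EFin//; last 3 first.
  - by move=> t _; rewrite lee_fin mulr_ge0 ?tpow_ge0.
  - by apply/measurable_EFinP; exact: mabs.
  - by rewrite invr_ge0 ltW.
  by rewrite EFinM lee_pmul2l// ?lte_fin ?invr_gt0.
have ig : (mu \x mu)%E.-integrable setT (fun z => (g z.1 z.2)%:E).
  apply/integrable21ltyP; first exact/measurable_EFinP.
  by apply: le_lt_trans gabs _; exact: ltry.
have gs s : \int[mu]_t g s t = e * ((phi (x + e * s) - phi x) * tpow (- 1 - a) s).
  have [s0|s0] := ltP 0 s; last first.
    rewrite /g /tpow [in RHS]ltNge s0 /= !mulr0.
    under eq_Rintegral do rewrite [X in _ * X]ifF ?mulr0 ?ltNge ?s0//.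
    by rewrite Rintegral_cst// mul0r.
  rewrite RintegralZr//.
    by rewrite (integral_derive1_tpow x dphi cdphi he s0) mulrA.
  have := integrable_affine x he (integrable_of_support cdphi supp').
  apply: le_integrable => //.
    apply/measurable_EFinP; apply: measurable_funM.
      by apply: measurable_comp_affine; exact: continuous_measurable_fun.
    apply: measurable_funM; first exact: measurable_tpow.
    by apply: measurableT_comp; [exact: measurable_tpow|exact: measurable_funB].
  move=> t _ /=; rewrite lee_fin normrM ler_piMr//.
  rewrite ger0_norm ?mulr_ge0 ?tpow_ge0// /tpow.
  by case: ifP => _; case: ifP => _; rewrite ?powRr0 ?mulr0 ?mul0r ?mulr1.
have gt t : \int[mu]_s g s t = a^-1 * (derive1 phi (x + e * t) * tpow (- a) t).
  have [t0|t0] := ltP 0 t; last first.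
    rewrite /g /tpow [in RHS]ltNge t0 /= !mulr0.
    under eq_Rintegral do
      rewrite [X in _ * (X * _)]ifF ?mulr0 ?mul0r ?mulr0 ?mul0r ?ltNge ?t0//.
    by rewrite Rintegral_cst// mul0r.
  transitivity (\int[mu]_s ((derive1 phi (x + e * t) * tpow 0 t) *
        (tpow 0 (s - t) * tpow (- 1 - a) s))).
    by apply: eq_Rintegral => s _; rewrite /g !mulrA.
  rewrite RintegralZl//; last exact: itail.
  rewrite [X in _ * X]/Rintegral integral_tpow_tail//= /tpow t0 powRr0 mulr1.
  by rewrite mulrCA.
have ih : mu.-integrable setT
    (EFin \o (fun s => (phi (x + e * s) - phi x) * tpow (- 1 - a) s)).
  have := integrableZl measurableT e (integrable_Rintegral ig).
  by apply: eq_integrable => // s _ /=; rewrite gs -EFinM; congr EFin; exact: eK.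
split; first exact: ih.
(* Up to the sign [e], the increment is the [t]-integral of [g], so its absolute value is at most
   the [t]-integral of [|g|]; Tonelli then restores the order used in [gabs]. *)
- apply: le_trans gabs.
  have mgabs : measurable_fun [set: R * R] (fun z => `|g z.1 z.2|%:E)%E.
    by apply/measurable_EFinP; apply: measurableT_comp.
  rewrite -(@fubini_tonelli _ _ _ _ _ mu mu (fun z => `|g z.1 z.2|%:E)%E)//.
  apply: ge0_le_integral => //.
  + apply/measurable_EFinP; apply: measurableT_comp => //.
    apply: measurable_funM; last exact: measurable_tpow.
    apply: measurable_funB => //; apply: measurable_comp_affine.
    exact: continuous_measurable_fun.
  + exact: (@measurable_fun_fubini_tonelli_F _ _ _ _ _ mu (fun z => `|g z.1 z.2|%:E)%E
      mgabs (fun z => normr_ge0 _)).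
  move=> s _.
  have -> : `|(phi (x + e * s) - phi x) * tpow (- 1 - a) s| = `|\int[mu]_t g s t|.
    by rewrite gs [RHS]normrM e1 mul1r.
  apply: le_trans (abse_fine_le _) _.
  apply: le_abse_integral => //.
  by apply/measurable_EFinP; exact: mgS.
(* The two orders of integration give [e * I = J / a]; multiplying by [e * a] and using [e^2 = 1]
   yields the claim. *)
- set J := (X in e * X = _); set I := (X in _ = a * X).
  have gsE : \int[mu]_s \int[mu]_t g s t = e * I.
    rewrite -(RintegralZl e measurableT ih).
    by apply: eq_Rintegral => s _; exact: gs.
  have gtE : \int[mu]_t \int[mu]_s g s t = a^-1 * J.
    have iphi := integrable_support_tpow x cdphi he a01 supp'.
    rewrite -(RintegralZl a^-1 measurableT iphi).
    by apply: eq_Rintegral => t _; exact: gt.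
  have -> : J = a * (e * I).
    by rewrite -gsE (Rfubini ig) gtE mulrA mulfV ?gt_eqF// mul1r.
  by rewrite mulrCA eK.
Qed.

End marchaud.

(** * Fractional integrals as integrals over the line, and the Gagliardo bound *)

Section gagliardo.
Context {R : realType}.
Local Notation mu := (@lebesgue_measure R).
Implicit Types (a e x : R) (u f phi : R -> R).

(** The substitution [y = x + t] moves [x] from the kernel into [phi]; the left integral below uses
    [y = x - t] in the same way. *)
Lemma right_frac_intE a phi x : measurable_fun [set: R] phi ->
  right_frac_int (1 - a) phi x =
  (Gamma (1 - a))^-1 * \int[mu]_t (phi (x + 1 * t) * tpow (- a) t).
Proof.
move=> mphi; rewrite /right_frac_int; congr (_ * _).
have mG : measurable_fun [set: R] (fun y => phi y * tpow (- a) (y - x)).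
  apply: measurable_funM => //; apply: measurableT_comp; first exact: measurable_tpow.
  exact: measurable_funB.
transitivity (\int[mu]_y (phi y * tpow (- a) (y - x))).
  rewrite Rintegral_mkcond; apply: eq_Rintegral => y _.
  rewrite patchE mem_setE in_itv/= andbT /tpow subr_gt0.
  by case: ifP => _; rewrite ?mulr0// subKr powRN.
rewrite -(Rintegral_affine x (or_introl erefl) mG).
by apply: eq_Rintegral => t _; rewrite mul1r (addrC x) addrK.
Qed.

Lemma left_frac_intE a phi x : measurable_fun [set: R] phi ->
  left_frac_int (1 - a) phi x =
  (Gamma (1 - a))^-1 * \int[mu]_t (phi (x + -1 * t) * tpow (- a) t).
Proof.
move=> mphi; rewrite /left_frac_int; congr (_ * _).
have mG : measurable_fun [set: R] (fun y => phi y * tpow (- a) (x - y)).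
  apply: measurable_funM => //; apply: measurableT_comp; first exact: measurable_tpow.
  exact: measurable_funB.
transitivity (\int[mu]_y (phi y * tpow (- a) (x - y))).
  rewrite Rintegral_mkcond; apply: eq_Rintegral => y _.
  rewrite patchE mem_setE in_itv/= /tpow subr_gt0.
  by case: ifP => _; rewrite ?mulr0// subKr powRN.
rewrite -(Rintegral_affine x (or_intror erefl) mG).
by apply: eq_Rintegral => t _; rewrite mulN1r opprB addrCA subrr addr0.
Qed.

(** For a fixed outer variable [y], putting [x = y - e * s] in the Gagliardo integral and keeping
    only [s > 0] leaves the integral of the absolute value of this function. *)
Lemma gagliardo_integrable a e u : 0 < a < 1 -> e = 1 \/ e = -1 ->
  gagliardo_space a u ->
  (mu \x mu)%E.-integrable setT
    (fun z => ((u z.1 - u (z.1 + - e * z.2)) * tpow (- 1 - a) z.2)%:E).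
Proof.
move=> a01 he [/integrableP[/measurable_EFinP mU _] gu].
have he' : - e = 1 \/ - e = -1.
  by case: he => ->; [right|left; rewrite opprK].
have mw : measurable_fun [set: R * R]
    (fun z : R * R => (u z.1 - u (z.1 + - e * z.2)) * tpow (- 1 - a) z.2).
  apply: measurable_funM; last first.
    by apply: measurableT_comp; [exact: measurable_tpow|exact: measurable_snd].
  apply: measurable_funB; first by apply: measurableT_comp => //; exact: measurable_fst.
  apply: measurableT_comp => //; apply: measurable_funD; first exact: measurable_fst.
  by apply: measurable_funM => //; exact: measurable_snd.
apply/integrable12ltyP; first exact/measurable_EFinP.
apply: le_lt_trans gu.
pose k (y x : R) : R := `|u x - u y| * `|x - y| `^ (- (1 + a)).
have kE y x : `|u x - u y| / `|x - y| `^ (1 + a) = k y x by rewrite /k powRN.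
have mk : measurable_fun [set: R * R] (fun z : R * R => k z.1 z.2).
  apply: measurable_funM.
    apply: measurableT_comp => //; apply: measurable_funB.
      by apply: measurableT_comp => //; exact: measurable_snd.
    by apply: measurableT_comp => //; exact: measurable_fst.
  apply: (measurableT_comp (measurable_powR (- (1 + a)))).
  apply: measurableT_comp => //.
  by apply: measurable_funB; [exact: measurable_snd|exact: measurable_fst].
have k0 y x : 0 <= k y x by rewrite /k mulr_ge0// powR_ge0.
have mkT y : measurable_fun [set: R] (k y).
  exact: (measurableT_comp (f := fun z : R * R => k z.1 z.2) mk (measurable_pair1 y)).
have mwT y : measurable_fun [set: R] (fun s => (u y - u (y + - e * s)) * tpow (- 1 - a) s).
  exact: (measurableT_comp
    (f := fun z : R * R => (u z.1 - u (z.1 + - e * z.2)) * tpow (- 1 - a) z.2)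
    mw (measurable_pair1 y)).
have mwabs : measurable_fun [set: R * R]
    (fun z : R * R => `|(u z.1 - u (z.1 + - e * z.2)) * tpow (- 1 - a) z.2|%:E)%E.
  by apply/measurable_EFinP; apply: measurableT_comp.
have mk' : measurable_fun [set: R * R] (fun z : R * R => (k z.1 z.2)%:E)%E.
  exact/measurable_EFinP.
have -> : (\int[mu]_y \int[mu]_x (`|u x - u y| / `|x - y| `^ (1 + a))%:E =
    \int[mu]_y \int[mu]_x (k y x)%:E)%E.
  by apply: eq_integral => y _; apply: eq_integral => x _; rewrite kE.
apply: ge0_le_integral.
- exact: measurableT.
- by move=> x _; exact: integral_ge0.
- exact: (@measurable_fun_fubini_tonelli_F _ _ _ _ _ mu _ mwabs (fun z => normr_ge0 _)).
- exact: (@measurable_fun_fubini_tonelli_F _ _ _ _ _ mu _ mk' (fun z => k0 _ _)).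
move=> y _.
have mky : measurable_fun [set: R] (fun x => (k y x)%:E)%E.
  by apply/measurable_EFinP; exact: mkT.
rewrite -(@ge0_integral_affine R y (- e) (fun x => (k y x)%:E)%E he' mky (fun x => k0 y x)).
apply: ge0_le_integral.
- exact: measurableT.
- by move=> x _.
- by apply/measurable_EFinP; apply: measurableT_comp => //; exact: mwT.
- by apply/measurable_EFinP; apply: measurable_comp_affine; exact: mkT.
move=> s _; rewrite lee_fin normrM (ger0_norm (tpow_ge0 _ _)) /k distrC.
rewrite (addrC y) addrK.
have e1 : `|- e| = 1 by case: he' => ->; rewrite ?normrN normr1.
(* For [s <= 0] the truncated power is 0 and the bound is mere nonnegativity; for [s > 0] the two
   kernels coincide. *)
rewrite normrM e1 mul1r ler_wpM2l// /tpow opprD.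
by case: ltP => s0; rewrite ?powR_ge0// ger0_norm// ltW.
Qed.

End gagliardo.

(** * Integration by parts for functions of finite Gagliardo seminorm *)

Section weak_derivative.
Context {R : realType}.
Local Notation mu := (@lebesgue_measure R).
Implicit Types (a c e x : R) (u v phi : R -> R).

(** Here [c] stands for [1 / Gamma(1 - a)]. The factor [- e] produces the right fractional
    derivative of [phi] for [e = 1] and the left one for [e = -1], so both weak derivatives are
    covered. *)
Lemma gagliardo_weak_derivative a c e u : 0 < a < 1 -> e = 1 \/ e = -1 ->
  gagliardo_space a u ->
  exists2 v, L1 v & forall phi, test_function phi ->
    \int[mu]_x (v x * phi x) =
    \int[mu]_x (u x *
      - (e * derive1 (fun x => c * \int[mu]_t (phi (x + e * t) * tpow (- a) t)) x)).
Proof.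
move=> a01 he gu; have [iu _] := gu.
pose w x s := (u x - u (x + - e * s)) * tpow (- 1 - a) s.
have iw : (mu \x mu)%E.-integrable setT (fun z => (w z.1 z.2)%:E).
  exact: gagliardo_integrable.
have iv := integrable_Rintegral iw.
exists (fun x => (c * a) * \int[mu]_s w x s).
  exact: (integrableZl measurableT (c * a) iv).
move=> phi tphi.
have [dphi cdphi [A [A0 phi0]]] := test_functionP tphi.
have cphi : continuous phi.
  by move=> y; apply/differentiable_continuous/derivable1_diffP.
have mphi : measurable_fun [set: R] phi by exact: continuous_measurable_fun.
have supp y : A < `|y| -> phi y = 0 by move=> /phi0[].
have [M [M0 phiM]] := bounded_of_support cphi supp.
have [C hC] := marchaud tphi he a01.
have /measurable_EFinP mU := measurable_int _ iu.
pose h x s := (phi (x + e * s) - phi x) * tpow (- 1 - a) s.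
pose I x := \int[mu]_s h x s.
have DE x : - (e * derive1 (fun x => c * \int[mu]_t (phi (x + e * t) * tpow (- a) t)) x) =
    - (c * (a * I x)).
  have [d1 d2] := derive1_frac_int x tphi he a01.
  have [_ _ hI] := hC x.
  by rewrite derive1E (deriveMl c d1) -derive1E d2 mulrCA hI.
have mh : measurable_fun [set: R * R] (fun z : R * R => h z.1 z.2).
  apply: measurable_funM; last first.
    by apply: measurableT_comp; [exact: measurable_tpow|exact: measurable_snd].
  apply: measurable_funB; last by apply: measurableT_comp => //; exact: measurable_fst.
  apply: measurableT_comp => //; apply: measurable_funD; first exact: measurable_fst.
  by apply: measurable_funM => //; exact: measurable_snd.
have mhT x : measurable_fun [set: R] (h x).
  exact: (measurableT_comp (f := fun z : R * R => h z.1 z.2) mh (measurable_pair1 x)).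
(* [H1] carries the difference quotient on [u], [H2] carries it on [phi]. Both are integrable in the
   pair [(x, s)], and their [x]-integrals agree for each [s]. *)
pose H1 x s := w x s * phi x.
pose H2 x s := - u x * h x s.
have iH1 : (mu \x mu)%E.-integrable setT (fun z => (H1 z.1 z.2)%:E).
  have := integrableZl measurableT M iw.
  apply: le_integrable; first exact: measurableT.
    apply/measurable_EFinP; apply: measurable_funM.
      by apply/measurable_EFinP; exact: measurable_int iw.
    by apply: measurableT_comp => //; exact: measurable_fst.
  move=> z _; rewrite -EFinM lee_fin !normrM (gtr0_norm M0) mulrC.
  by rewrite ler_wpM2r.
have iH2 : (mu \x mu)%E.-integrable setT (fun z => (H2 z.1 z.2)%:E).
  apply/integrable12ltyP.
    apply/measurable_EFinP; apply: measurable_funM => //.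
    apply: measurable_funN.
    by apply: measurableT_comp => //; exact: measurable_fst.
  (* For each [x] the [s]-integral of [|h x s|] is at most [C], so the double integral is at most
     [C] times the [L^1] norm of [u]. *)
  apply: (@le_lt_trans _ _ (\int[mu]_x (C%:E * `|(EFin \o u) x|))%E).
    apply: ge0_le_integral.
    - exact: measurableT.
    - by move=> x _; exact: integral_ge0.
    - have mH : measurable_fun [set: R * R] (fun z : R * R => `|H2 z.1 z.2|%:E)%E.
        apply/measurable_EFinP; apply: measurableT_comp => //.
        apply: measurable_funM => //; apply: measurable_funN.
        by apply: measurableT_comp => //; exact: measurable_fst.
      exact: (@measurable_fun_fubini_tonelli_F _ _ _ _ _ mu _ mH (fun z => normr_ge0 _)).
    - apply/measurable_EFinP; apply: measurable_funM => //.
      by apply: measurableT_comp.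
    move=> x _.
    have -> : (\int[mu]_y `|(H2 (x, y).1 (x, y).2)%:E| = `|u x|%:E * \int[mu]_s `|h x s|%:E)%E.
      rewrite -ge0_integralZl_EFin.
      - by apply: eq_integral => s _; rewrite /= normrM normrN EFinM.
      - exact: measurableT.
      - by move=> s _.
      - by apply/measurable_EFinP; apply: measurableT_comp => //; exact: mhT.
      - exact: normr_ge0.
    have [_ hle _] := hC x.
    by rewrite muleC; apply: lee_wpmul2r.
  exact: (integrable_lty measurableT (integrableZl measurableT C (integrable_abse iu))).
have iB (U psi : R -> R) :
    mu.-integrable setT (EFin \o U) -> measurable_fun [set: R] psi ->
    (forall x, `|psi x| <= M) ->
    mu.-integrable setT (EFin \o (fun x : R => U x * psi x)).
  move=> iU mpsi psiM; have /measurable_EFinP mmU := measurable_int _ iU.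
  have := integrableZl measurableT M iU.
  apply: le_integrable; first exact: measurableT.
    by apply/measurable_EFinP; apply: measurable_funM.
  move=> x _; rewrite -EFinM lee_fin !normrM (gtr0_norm M0) mulrC.
  by rewrite ler_wpM2r.
(* With [s] fixed, the terms of each difference are separately integrable in [x], and translation by
   [e * s] exchanges [u(x - e * s) * phi(x)] with [u(x) * phi(x + e * s)]. *)
have swap s : \int[mu]_x H1 x s = \int[mu]_x H2 x s.
  have he' : - e = 1 \/ - e = -1.
    by case: he => ->; [right|left; rewrite opprK].
  have shiftE (f : R -> R) (b x : R) : f (b + 1 * x) = f (x + b) by rewrite mul1r addrC.
  have iq0 : mu.-integrable setT (EFin \o (fun x => u (x + - e * s))).
    have := integrable_affine (- e * s) (or_introl erefl : (1:R) = 1 \/ (1:R) = -1) iu.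
    by apply: eq_integrable => // x _; rewrite /= shiftE.
  have ip := iB _ _ iu mphi phiM.
  have iq := iB _ _ iq0 mphi phiM.
  have mphis : measurable_fun [set: R] (fun x => phi (x + e * s)).
    by apply: measurableT_comp => //; exact: measurable_funD.
  have ir := iB _ _ iu mphis (fun x => phiM _).
  have qr : \int[mu]_x (u (x + - e * s) * phi x) = \int[mu]_x (u x * phi (x + e * s)).
    have mq := measurable_int _ iq; move/measurable_EFinP : mq => mq.
    rewrite -(Rintegral_affine (e * s) (or_introl erefl : (1:R) = 1 \/ (1:R) = -1) mq).
    apply: eq_Rintegral => x _.
    by rewrite mul1r (addrC (e * s)) mulNr addrK.
  transitivity (\int[mu]_x (tpow (- 1 - a) s * (u x * phi x - u (x + - e * s) * phi x))).
    by apply: eq_Rintegral => x _; rewrite /H1 /w -mulrBl mulrAC mulrC.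
  transitivity (\int[mu]_x (tpow (- 1 - a) s * (u x * phi x - u x * phi (x + e * s)))); last first.
    apply: eq_Rintegral => x _; rewrite /H2 /h -mulrBr.
    by rewrite [RHS]mulNr -[RHS]mulrN -mulNr opprB [LHS]mulrC -mulrA.
  rewrite (RintegralZl _ measurableT (integrableB measurableT ip iq)).
  rewrite (RintegralZl _ measurableT (integrableB measurableT ip ir)).
  by rewrite (RintegralB measurableT ip iq) (RintegralB measurableT ip ir) qr.
(* The section [w x] is integrable only for almost every [x], so [phi x] enters the inner integral
   only almost everywhere. *)
have aeE : \int[mu]_x ((\int[mu]_s w x s) * phi x) = \int[mu]_x \int[mu]_s H1 x s.
  congr fine; apply: ae_eq_integral.
  - exact: measurableT.
  - apply/measurable_EFinP; apply: measurable_funM => //.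
    by apply/measurable_EFinP; exact: measurable_int iv.
  - exact: measurable_int (integrable_Rintegral iH1).
  - have := ae_integrable1 iw; apply: filterS => x ix _.
    by congr EFin; rewrite (RintegralZr _ measurableT ix).
have iwphi : mu.-integrable setT (EFin \o (fun x => (\int[mu]_s w x s) * phi x)).
  exact: iB.
have H2E x : \int[mu]_s H2 x s = - u x * I x.
  by have [ih _ _] := hC x; rewrite /H2 (RintegralZl _ measurableT ih).
have iH2' : mu.-integrable setT (EFin \o (fun x => - u x * I x)).
  by have := integrable_Rintegral iH2; apply: eq_integrable => // x _; rewrite /= H2E.
(* The left side reaches this middle term by Fubini for [H1], the equality at each [s], and Fubini
   for [H2]; the right side reaches it by the Marchaud form [DE]. *)
transitivity (c * a * \int[mu]_x (- u x * I x)).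
  have -> : \int[mu]_x (- u x * I x) = \int[mu]_x \int[mu]_s H2 x s.
    by apply: eq_Rintegral => x _; rewrite H2E.
  have -> : \int[mu]_x \int[mu]_s H2 x s = \int[mu]_x ((\int[mu]_s w x s) * phi x).
    rewrite aeE (Rfubini iH2) (Rfubini iH1).
    by apply: eq_Rintegral => s _; rewrite swap.
  rewrite -(RintegralZl _ measurableT iwphi).
  by apply: eq_Rintegral => x _; rewrite mulrA.
rewrite -(RintegralZl _ measurableT iH2').
apply: eq_Rintegral => x _; rewrite DE.
by rewrite !mulrN !mulNr !mulrN mulrCA !mulrA (mulrC (u x)) -!mulrA.
Qed.

End weak_derivative.

(** * The two inclusions, one for each direction *)

Theorem theorem5p17 (R : realType) (alpha : R) (halpha : 0 < alpha < 1) :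
  gagliardo_space alpha `<=` left_frac_sobolev alpha /\
  gagliardo_space alpha `<=` right_frac_sobolev alpha.
Proof.
have mtest phi : test_function phi -> measurable_fun [set: R] phi.
  move=> /test_functionP[dphi _ _]; apply: continuous_measurable_fun => y.
  exact/differentiable_continuous/derivable1_diffP.
split=> u gu; have [iu _] := gu; split=> //.
(* The left weak derivative is tested against right derivatives of [phi], which is the case
   [e = 1]. *)
- have [v iv vE] := gagliardo_weak_derivative (Gamma (1 - alpha))^-1 halpha
    (or_introl erefl : (1:R) = 1 \/ (1:R) = -1) gu.
  exists v => //; split => //.
    by apply: open_integrable_locally => //; exact: openT.
  move=> phi tphi; rewrite (vE _ tphi); apply: eq_Rintegral => x _.
  rewrite /right_frac_deriv mul1r; congr (_ * - _).
  congr (derive1 _ x); apply/funext => y.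
  by rewrite right_frac_intE//; exact: mtest.
(* With [e = -1] the two minus signs cancel, matching the left derivative, which is defined without
   a sign. *)
- have [v iv vE] := gagliardo_weak_derivative (Gamma (1 - alpha))^-1 halpha
    (or_intror erefl : (-1:R) = 1 \/ (-1:R) = -1) gu.
  exists v => //; split => //.
    by apply: open_integrable_locally => //; exact: openT.
  move=> phi tphi; rewrite (vE _ tphi); apply: eq_Rintegral => x _.
  rewrite /left_frac_deriv mulN1r opprK; congr (_ * _).
  congr (derive1 _ x); apply/funext => y.
  by rewrite left_frac_intE//; exact: mtest.
Qed.
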